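(* Let $a,b$ be real numbers with $1<a<b$. Then $$\pi=\frac{2\sqrt{(b^2-a^2)(a^2b^2-1)}}{a(b^2-1)}\;\frac{K\!\left(\dfrac{b(a^2-1)}{a(b^2-1)}\right)}{F_D^{(3)}\!\left(\tfrac12;-\tfrac12,\tfrac12,\tfrac12;1\,\Big|\,1-a^4,\dfrac{(a^4-1)b^2}{a^2-b^2},\dfrac{a^4-1}{a^2b^2-1}\right)}.$$
   Context: $K(k)=\int_0^1\frac{dx}{\sqrt{(1-x^2)(1-k^2x^2)}}$ is the complete elliptic integral of the first kind, as a function of the modulus $k$. The Lauricella function of $n$ variables is $F_D^{(n)}(\alpha;\beta_1,\dots,\beta_n;\gamma\,|\,x_1,\dots,x_n)=\sum_{m_1,\dots,m_n\ge0}\frac{(\alpha)_{m_1+\cdots+m_n}(\beta_1)_{m_1}\cdots(\beta_n)_{m_n}}{(\gamma)_{m_1+\cdots+m_n}\,m_1!\cdots m_n!}x_1^{m_1}\cdots x_n^{m_n}$ for $|x_j|<1$, with $(x)_k$ the Pochhammer symbol. For $\operatorname{Re}\gamma>\operatorname{Re}\alpha>0$ it equals, and outside the region of convergence is defined by analytic continuation through, $\frac{\Gamma(\gamma)}{\Gamma(\alpha)\Gamma(\gamma-\alpha)}\int_0^1\frac{u^{\alpha-1}(1-u)^{\gamma-\alpha-1}}{(1-x_1u)^{\beta_1}\cdots(1-x_nu)^{\beta_n}}\,du$ (principal branches, $x_j\notin[1,\infty)$). *)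

(* Defs.v *)
From mathcomp Require Import all_boot all_order all_algebra.
From mathcomp Require Import all_classical all_reals all_analysis.

Set Implicit Arguments.
Unset Strict Implicit.
Unset Printing Implicit Defensive.

Import Order.TTheory GRing.Theory Num.Theory.
Import numFieldNormedType.Exports.

Local Open Scope classical_set_scope.
Local Open Scope ring_scope.

(* All integrals below are real-valued Lebesgue integrals.  Where an integrand
   is singular at an endpoint, its value there (given by the conventions
   [0^-1 = 0] and [0 `^ r = 0] for [r != 0]) is irrelevant: points are null. *)

(* The argument is the modulus [k], not the parameter [k ^+ 2]. *)
Definition ellipticK (R : realType) (k : R) : R :=
  \int[@lebesgue_measure R]_(x in `[0, 1])
    (Num.sqrt ((1 - x ^+ 2) * (1 - k ^+ 2 * x ^+ 2)))^-1.

Definition Gamma (R : realType) (s : R) : R :=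
  \int[@lebesgue_measure R]_(t in `[0, +oo[) (t `^ (s - 1) * expR (- t)).

Definition pochhammer (R : realType) (x : R) (k : nat) : R :=
  \prod_(i < k) (x + i%:R).

Definition lauricella_term (R : realType) (n : nat) (alpha : R)
    (beta : n.-tuple R) (gamma : R) (x : n.-tuple R) (m : 'I_n -> nat) : R :=
  (pochhammer alpha (\sum_(j < n) m j)%N
     * \prod_(j < n) pochhammer (tnth beta j) (m j))
  / (pochhammer gamma (\sum_(j < n) m j)%N * \prod_(j < n) ((m j)`!)%:R)
  * \prod_(j < n) tnth x j ^+ m j.

(* The multiple series is summed as the limit of its partial sums over the
   cubes [0 <= m_1, ..., m_n < M]; it converges absolutely when every
   [|x_j| < 1] (and [gamma] is not a nonpositive integer), so the order of
   summation is immaterial there. *)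
Definition lauricella_series (R : realType) (n : nat) (alpha : R)
    (beta : n.-tuple R) (gamma : R) (x : n.-tuple R) : R :=
  limn (fun M : nat => \sum_(m : {ffun 'I_n -> 'I_M})
    lauricella_term alpha beta gamma x (fun j => m j : nat)).

(* For [x_j < 1] and [0 <= u < 1] the bases [1 - x_j * u] are positive reals,
   on which [`^] is the principal branch of the power. *)
Definition lauricella_integral (R : realType) (n : nat) (alpha : R)
    (beta : n.-tuple R) (gamma : R) (x : n.-tuple R) : R :=
  Gamma gamma / (Gamma alpha * Gamma (gamma - alpha))
  * \int[@lebesgue_measure R]_(u in `[0, 1])
      (u `^ (alpha - 1) * (1 - u) `^ (gamma - alpha - 1)
       / \prod_(j < n) (1 - tnth x j * u) `^ (tnth beta j)).

(* Lauricella's F_D for real parameters and arguments: the series inside the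
   polydisc of convergence, Euler's integral outside it.  The second branch is
   meaningful for [0 < alpha < gamma] and all [x_j < 1]. *)
Definition lauricellaFD (R : realType) (n : nat) (alpha : R)
    (beta : n.-tuple R) (gamma : R) (x : n.-tuple R) : R :=
  if [forall j, `|tnth x j| < 1] then lauricella_series alpha beta gamma x
  else lauricella_integral alpha beta gamma x.

(* Main.v *)
Require Import Defs.
From mathcomp Require Import all_boot all_order all_algebra.
From mathcomp Require Import all_classical all_reals all_analysis.
From mathcomp Require Import measurable_realfun ring lra.

Set Implicit Arguments.
Unset Strict Implicit.
Unset Printing Implicit Defensive.

Import Order.TTheory GRing.Theory Num.Theory.
Import numFieldNormedType.Exports.

Local Open Scope classical_set_scope.
Local Open Scope ring_scope.

(**
Let [alpha = 1/2] and [gamma = 1].  Since [Gamma 1 = 1] and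
[Gamma (1/2) ^+ 2 = pi], Euler's formula reads
[pi * F_D = \int_0^1 Q(u) du], where [Q(u)] is the square root of
[(1 - x1 u) / (u (1 - u) (1 - x2 u) (1 - x3 u))].  The theorem says that
this integral is [C * K(k)], with the explicit constant [C] and modulus [k].

The differential lives on a curve of genus two with branch points 0, 1,
[1 / x1], [1 / x2], [1 / x3] and infinity.  In the coordinate
[s = (1 + (a^4 - 1) u) / a^2] they become [a^-2], [a^2], 0, [b^-2], [b^2] and
infinity, a set stable under the inversion of [s]; this extra involution makes
the integral reducible to an elliptic one.  Put [s = r^2]
and [r - 1/r = (a - 1/a) sin t]: then [t] runs over [[- pi/2, pi/2]], the
involution is the change of [t] into [- t], and
[Q(u) du = C * (r / (r + 1/r)) / sqrt (1 - k^2 sin^2 t) dt].  Adding the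
values at [t] and [- t] turns the factor [r / (r + 1/r)] into 1, and leaves
Legendre's form of [K(k)] on [[0, pi/2]] ([integral_euler_integrand]).  As
[K(k) > 0], one may divide ([ellipticK_gt0]).

For fixed [b] and [a] close to 1 all three arguments have absolute value less than 1, and
[F_D] is then the sum of the series.  There Euler's formula has to be proved
([lauricella_series_integral]): the ratio of Pochhammer symbols of index
[m1 + m2 + m3] is a moment of the arcsine law, hence a partial sum over a cube
is the integral of the arcsine kernel times a product of partial sums of
binomial series, and dominated convergence concludes.

All the changes of variables concern integrands that are singular at the ends
of the interval of integration; they are instances of one improper
substitution rule for nonnegative functions ([ge0_integral_image]).
*)

(** * Improper substitution *)

Section substitution.
Context {R : realType}.
Notation mu := (@lebesgue_measure R).
Implicit Types F f G : R -> R.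

Lemma is_derive_continuous F (x df : R) : is_derive x 1 F df -> {for x, continuous F}.
Proof.
by case=> dF _; apply/differentiable_continuous/derivable1_diffP.
Qed.

Lemma derive_gt0_lt F f (x y : R) : x < y ->
  {within `[x, y], continuous F} ->
  {in `]x, y[, forall z : R, is_derive z 1 F (f z) /\ 0 < f z} -> F x < F y.
Proof.
move=> xy cF dF.
have [z zxy Fyx] : exists2 z, z \in `]x, y[ & F y - F x = f z * (y - x).
  by apply: MVT => // z zxy; exact: (dF _ zxy).1.
by rewrite -subr_gt0 Fyx mulr_gt0 ?subr_gt0//; exact: (dF _ zxy).2.
Qed.

Lemma integral_subst_itvcc F f G (a b : R) : a <= b ->
  {in `[a, b], forall z : R, [/\ is_derive z 1 F (f z), 0 < f z,
    {for z, continuous f} & {for F z, continuous G}]} ->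
  (\int[mu]_(y in `[F a, F b]) (G y)%:E =
   \int[mu]_(x in `[a, b]) (G (F x) * f x)%:E)%E.
Proof.
move=> ab H.
have [{ab}ab|ba] := ltP a b; last first.
  have -> : b = a by apply/eqP; rewrite eq_le ab ba.
  by rewrite !set_itv1 !integral_set1.
have cF : {in `[a, b], continuous F}.
  by move=> x xab; have [dF _ _ _] := H _ xab; exact: is_derive_continuous dF.
have homoF : {in `[a, b] &, {homo F : x y / x < y}}.
  move=> x y /[!in_itv]/= /andP[ax xb] /andP[ay yb] xy.
  have xyab : `[x, y]%classic `<=` `[a, b]%classic.
    by apply: subset_itvScc; rewrite bnd_simp.
  apply: (@derive_gt0_lt F f) xy _ _ => [|z /subset_itv_oo_cc/xyab zab].
    by apply: continuous_in_subspaceT => z /[!inE] /xyab; exact: cF.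
  by have [] := H z zab.
have aI : a \in `[a, b] by rewrite in_itv/= lexx ltW.
have bI : b \in `[a, b] by rewrite in_itv/= lexx ltW.
have F'E : {in `]a, b[, F^`()%classic =1 f}.
  move=> x xab; have [|[_ dFx] _ _ _] := H x; first exact: subset_itv_oo_cc xab.
  by rewrite derive1E.
rewrite (integration_by_substitution_increasing (ltW ab) homoF).
- rewrite integral_itv_bndoo; last first.
    apply/measurable_EFinP; apply: (@eq_measurable_fun _ _ _ _ _
      (fun x => G (F x) * f x)).
      by move=> x /[!inE] xab /=; rewrite !fctE F'E.
    apply: open_continuous_measurable_fun => // x /[!inE] /= xab.
    have [|dF _ cf cG] := H x; first exact: subset_itv_oo_cc xab.
    by apply: cvgM => //; apply: continuous_comp => //; apply: cF;
      exact: subset_itv_oo_cc xab.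
  rewrite [RHS]integral_itv_bndoo; last first.
    apply/measurable_EFinP; apply: open_continuous_measurable_fun => // x /[!inE] /= xab.
    have [|dF _ cf cG] := H x; first exact: subset_itv_oo_cc xab.
    by apply: cvgM => //; apply: continuous_comp => //; apply: cF;
      exact: subset_itv_oo_cc xab.
  by apply: eq_integral => x /[!inE] xab; rewrite !fctE F'E.
- move=> x xab; have [|dF _ cf cG] := H x; first exact: subset_itv_oo_cc xab.
  rewrite /prop_for /continuous_at (F'E _ xab); apply: cvg_trans cf.
  apply: near_eq_cvg; near=> y; rewrite F'E//; near: y.
  exact: near_in_itvoo.
- apply/cvg_ex; exists (f a); have [_ _ cf _] := H _ aI.
  apply: cvg_trans (cvg_at_right_filter cf).
  by apply: near_eq_cvg; near=> y; rewrite F'E// in_itv/=; apply/andP; split.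
- apply/cvg_ex; exists (f b); have [_ _ cf _] := H _ bI.
  apply: cvg_trans (cvg_at_left_filter cf).
  by apply: near_eq_cvg; near=> y; rewrite F'E// in_itv/=; apply/andP; split.
- split.
  + move=> x xab; have [|[]//] := H x; exact: subset_itv_oo_cc xab.
  + by apply: cvg_at_right_filter; exact: cF.
  + by apply: cvg_at_left_filter; exact: cF.
- apply: continuous_in_subspaceT => y /[!inE] yab.
  have cFab : {within `[a, b], continuous F}.
    by apply: continuous_in_subspaceT => x /[!inE]; exact: cF.
  have [|x xab <-] := @IVT _ F a b y (ltW ab) cFab.
    move: yab; rewrite /= in_itv/= => /andP[ay yb].
    by rewrite ge_min ay le_max yb orbT.
  by have [] := H x xab.
Unshelve. all: by end_near. Qed.

(** The improper integrals below are limits of proper ones, taken along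
    compact intervals that increase to the domain. *)
Definition exhausted (a_ b_ : R^nat) (D : set R) :=
  [/\ forall n, a_ n <= b_ n, nonincreasing_seq a_, nondecreasing_seq b_ &
      D = \bigcup_n `[a_ n, b_ n]%classic].

(** Substitution on a domain where [F], [f] and [G] may blow up at the ends: on
    each compact interval of the exhaustion it is the classical formula, and
    both sides pass to the limit by monotone convergence since the integrands
    are nonnegative. *)
Lemma ge0_integral_image (a_ b_ : R^nat) (D : set R) F f G :
  exhausted a_ b_ D ->
  (forall x : R, D x -> [/\ is_derive x 1 F (f x), 0 < f x,
    {for x, continuous f}, {for F x, continuous G} & 0 <= G (F x)]) ->
  (\int[mu]_(y in F @` D) (G y)%:E = \int[mu]_(x in D) (G (F x) * f x)%:E)%E.
Proof.
move=> [ab na nb DE] H.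
have sub n : `[a_ n, b_ n]%classic `<=` D by rewrite DE => x ?; exists n.
have H' n : {in `[a_ n, b_ n], forall x : R, [/\ is_derive x 1 F (f x), 0 < f x,
    {for x, continuous f}, {for F x, continuous G} & 0 <= G (F x)]}.
  by move=> x xab; apply: H; apply: (sub n).
have cF n : {in `[a_ n, b_ n], continuous F}.
  by move=> x xab; have [dF _ _ _ _] := H' _ _ xab; exact: is_derive_continuous dF.
have homoF n : {in `[a_ n, b_ n] &, {homo F : x y / x <= y}}.
  move=> x y /[!in_itv]/= /andP[ax xb] /andP[ay yb].
  rewrite le_eqVlt => /predU1P[->//|xy]; apply/ltW.
  have xyab : `[x, y]%classic `<=` `[a_ n, b_ n]%classic.
    by apply: subset_itvScc; rewrite bnd_simp.
  apply: (@derive_gt0_lt F f) xy _ _ => [|z /subset_itv_oo_cc/xyab zab].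
    by apply: continuous_in_subspaceT => z /[!inE] /xyab; exact: (cF n).
  by have [] := H' n z zab.
have nested : forall m n, (m <= n)%N -> `[a_ m, b_ m]%classic `<=` `[a_ n, b_ n]%classic.
  move=> m n mn x /=; rewrite !in_itv/= => /andP[ax xb].
  by rewrite (le_trans (na _ _ mn) ax) (le_trans xb (nb _ _ mn)).
have aI n : a_ n \in `[a_ n, b_ n] by rewrite in_itv/= lexx ab.
have bI n : b_ n \in `[a_ n, b_ n] by rewrite in_itv/= lexx ab.
have imE n : F @` `[a_ n, b_ n] = `[F (a_ n), F (b_ n)]%classic.
  apply/seteqP; split => [_ [x xab <-]|y /=]; rewrite /= in_itv/=.
    have := xab; rewrite /= in_itv/= => /andP[ax xb].
    by rewrite !(homoF n).
  move=> /andP[ay yb].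
  have cFab : {within `[a_ n, b_ n], continuous F}.
    by apply: continuous_in_subspaceT => x /[!inE]; exact: cF.
  have [|x xab <-] := @IVT _ F _ _ y (ab n) cFab.
    by rewrite ge_min ay le_max yb orbT.
  by exists x.
have imDE : F @` D = \bigcup_n `[F (a_ n), F (b_ n)]%classic.
  by rewrite DE image_bigcup; apply: eq_bigcupr => n _; exact: imE.
rewrite imDE.
have cvgL : (\int[mu]_(y in `[F (a_ n), F (b_ n)]) (G y)%:E)%E @[n --> \oo]
    --> (\int[mu]_(y in \bigcup_n `[F (a_ n), F (b_ n)]%classic) (G y)%:E)%E.
  apply: ge0_nondecreasing_set_cvg_integral => //.
  - move=> m n mn; apply/subsetPset; rewrite -!imE; apply: image_subset.
    exact: nested.
  - move=> n; apply/measurable_EFinP; apply: subspace_continuous_measurable_fun => //.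
    apply: continuous_in_subspaceT => y; rewrite -imE inE/= => -[x xab <-].
    by have [] := H' n _ xab.
  - by move=> n y; rewrite -imE => -[x xab <-]; have [] := H' n _ xab.
have cvgR : (\int[mu]_(x in `[a_ n, b_ n]) (G (F x) * f x)%:E)%E @[n --> \oo]
    --> (\int[mu]_(x in D) (G (F x) * f x)%:E)%E.
  rewrite DE; apply: ge0_nondecreasing_set_cvg_integral => //.
  - by move=> m n mn; apply/subsetPset; exact: nested.
  - move=> n; apply/measurable_EFinP; apply: subspace_continuous_measurable_fun => //.
    apply: continuous_in_subspaceT => x /[!inE] xab.
    have [dF _ cf cG _] := H' n _ xab; apply: cvgM => //.
    by apply: continuous_comp => //; exact: cF xab.
  - by move=> n x xab; have [_ f0 _ _ G0] := H' n _ xab; rewrite lee_fin mulr_ge0// ltW.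
rewrite -(cvg_lim _ cvgL)// -(cvg_lim _ cvgR)//.
congr (limn _); apply/funext => n; apply: integral_subst_itvcc => //.
by move=> x xab; have [? ? ? ?] := H' _ _ xab; split.
Qed.

(** With [n.+2] the first interval is reduced to the midpoint, and none is
    empty. *)
Lemma exhausted_itvoo (l r : R) : l < r ->
  exhausted (fun n => l + (r - l) / n.+2%:R) (fun n => r - (r - l) / n.+2%:R)
    `]l, r[%classic.
Proof.
move=> lr; have rl0 : 0 < r - l by rewrite subr_gt0.
have inv2 n : (n.+2%:R : R)^-1 <= 2^-1 by rewrite lef_pV2 ?posrE// ler_nat.
have dec m n : (m <= n)%N -> (r - l) / n.+2%:R <= (r - l) / m.+2%:R :> R.
  by move=> mn; rewrite ler_pM2l// lef_pV2 ?posrE// ler_nat !ltnS.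
split.
- move=> n; have : (r - l) / n.+2%:R <= (r - l) / 2 by rewrite ler_pM2l.
  set d := _ / n.+2%:R; lra.
- by move=> m n mn; rewrite lerD2l dec.
- by move=> m n mn; rewrite lerD2l lerN2 dec.
- apply/seteqP; split => [x|x [n _]] /=; last first.
    have e0 : 0 < (r - l) / n.+2%:R by rewrite divr_gt0.
    move: e0; set d := _ / n.+2%:R => e0; rewrite !in_itv/=; lra.
  rewrite in_itv/= => /andP[lx xr].
  pose d := Num.min (x - l) (r - x).
  have d0 : 0 < d by rewrite lt_min !subr_gt0 lx.
  pose n := Num.truncn ((r - l) / d).
  have dn : (r - l) / n.+2%:R <= d.
    rewrite ler_pdivrMr// mulrC -ler_pdivrMr//.
    rewrite (le_trans (ltW (truncnS_gt _)))// ler_nat; exact: leqnSn.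
  exists n => //=; rewrite in_itv/=.
  move: dn; set e := _ / n.+2%:R; rewrite le_min => /andP[]; lra.
Qed.

(** Continuity of [F] at the ends and the intermediate value theorem identify
    the image of the open interval. *)
Lemma ge0_integral_subst_itvoo F f G (l r : R) : l < r ->
  {within `[l, r], continuous F} ->
  {in `]l, r[, forall x : R, [/\ is_derive x 1 F (f x), 0 < f x &
    {for x, continuous f}]} ->
  {in `]F l, F r[, forall y, {for y, continuous G} /\ 0 <= G y} ->
  (\int[mu]_(y in `]F l, F r[) (G y)%:E =
   \int[mu]_(x in `]l, r[) (G (F x) * f x)%:E)%E.
Proof.
move=> lr cF dF HG.
have homoF : {in `[l, r] &, {homo F : x y / x < y}}.
  move=> x y /[!in_itv]/= /andP[lx xr] /andP[ly yr] xy.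
  apply: (@derive_gt0_lt F f) xy _ _ => [|z].
    by apply: continuous_subspaceW cF; apply: subset_itvScc; rewrite bnd_simp.
  rewrite in_itv/= => /andP[xz zy].
  have [|? ? _] := dF z; last by split.
  by rewrite in_itv/= (le_lt_trans lx xz) (lt_le_trans zy yr).
have lI : l \in `[l, r] by rewrite in_itv/= lexx ltW.
have rI : r \in `[l, r] by rewrite in_itv/= lexx ltW.
have FI x : x \in `]l, r[ -> F x \in `]F l, F r[.
  move=> /[dup] /subset_itv_oo_cc xlr; rewrite !in_itv/= => /andP[lx xr].
  by rewrite !homoF.
rewrite -(ge0_integral_image (exhausted_itvoo lr)); last first.
  by move=> x xlr; have [? ? ?] := dF _ xlr; have [? ?] := HG _ (FI _ xlr).
suff -> : F @` `]l, r[ = `]F l, F r[%classic by [].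
apply/seteqP; split => [_ [x xlr <-]|y /=]; first exact: FI.
rewrite in_itv/= => /andP[ly yr].
have [|x] := @IVT _ F l r y (ltW lr) cF.
  by rewrite ge_min (ltW ly) le_max (ltW yr) orbT.
rewrite in_itv/= !le_eqVlt => /andP[/predU1P[<-|lx] /predU1P[xr|xr]] Fxy.
- by move: ly; rewrite -Fxy ltxx.
- by move: ly; rewrite -Fxy ltxx.
- by move: yr; rewrite -Fxy xr ltxx.
- by exists x => //=; rewrite in_itv/= lx.
Qed.

(** Form used below when the range of integration is bounded: the singularities
    of [G] at the ends cancel against the zeros of the derivative [f], so that
    the pulled-back integrand extends to a continuous function [h] on the
    closed interval. *)
Lemma ge0_integral_subst_improper F f G h (l r : R) : l < r ->
  {within `[l, r], continuous F} ->
  {in `]l, r[, forall x : R, [/\ is_derive x 1 F (f x), 0 < f x &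
    {for x, continuous f}]} ->
  {in `]F l, F r[, forall y : R, {for y, continuous G} /\ 0 <= G y} ->
  {within `[l, r], continuous h} ->
  {in `]l, r[, forall x, G (F x) * f x = h x} ->
  (\int[mu]_(y in `[F l, F r]) (G y)%:E = \int[mu]_(x in `[l, r]) (h x)%:E)%E.
Proof.
move=> lr cF dF HG ch GFh.
rewrite integral_itv_bndoo; last first.
  apply/measurable_EFinP; apply: open_continuous_measurable_fun => // y.
  by rewrite inE => /HG[].
rewrite (ge0_integral_subst_itvoo lr cF dF HG) [RHS]integral_itv_bndoo.
  by apply: eq_integral => x /[!inE] xlr; rewrite GFh.
apply/measurable_EFinP; apply: open_continuous_measurable_fun => // x.
by have [ch' _ _] := (continuous_within_itvP _ lr).1 ch; rewrite inE; exact: ch'.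
Qed.

End substitution.

(** * Gamma at one half and the moments of the arcsine law *)

Section gamma_half.
Context {R : realType}.
Notation mu := (@lebesgue_measure R).

Lemma continuous_powR_gt0 (p x : R) : 0 < x -> {for x, continuous (fun y : R => y `^ p)}.
Proof. by move=> /(is_derive1_powR p); exact: is_derive_continuous. Qed.

Lemma exhausted_itv0y :
  exhausted (fun n => (n.+1%:R : R)^-1) (fun n => n.+1%:R) `]0, +oo[%classic.
Proof.
split.
- move=> n; apply: (@le_trans _ _ 1); last by rewrite ler1n.
  by rewrite invf_le1// ler1n.
- by move=> m n mn; rewrite lef_pV2 ?posrE// ler_nat.
- by move=> m n mn; rewrite ler_nat.
- apply/seteqP; split => [x|x [n _]]/=; last first.
    rewrite !in_itv/= andbT => /andP[+ _]; apply: lt_le_trans.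
    by rewrite invr_gt0.
  rewrite in_itv/= andbT => x0.
  exists (Num.truncn (Num.max x x^-1)) => //=.
  have := truncnS_gt (Num.max x x^-1); set N := _.+1%:R => mN.
  move: mN; rewrite gt_max => /andP[xN xVN]; rewrite in_itv/= (ltW xN) andbT.
  by rewrite -[leRHS]invrK lef_pV2 ?posrE ?invr_gt0// ltW.
Qed.

Lemma Gamma1 : Gamma (1 : R) = 1.
Proof.
rewrite /Gamma; under eq_Rintegral do rewrite subrr powRr0 mul1r.
rewrite (@Rintegral_ge0_continuous_FTC2y _ _ (fun x => - expR (- x)) _ 0)//.
- by rewrite oppr0 expR0 opprK add0r.
- by apply: continuous_subspaceT => x; apply: continuous_comp;
    [exact: continuousN|exact: continuous_expR].
- by rewrite -oppr0; apply: cvgN; exact: cvgr_expR.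
- by apply: cvg_at_right_filter; apply: cvgN; apply: continuous_comp;
    [exact: continuousN|exact: continuous_expR].
- move=> x _; rewrite derive1E.
  suff [] : is_derive x 1 (fun y : R => - expR (- y)) (expR (- x)) by [].
  by apply: is_derive_eq; rewrite mulrN1 opprK.
Qed.

(** The substitution [t = x ^+ 2] turns the integral into twice the Gaussian
    integral over the half-line. *)
Lemma Gamma_half : Gamma (1 / 2 : R) = Num.sqrt pi.
Proof.
rewrite /Gamma /Rintegral.
rewrite -integral_itv_obnd_cbnd; last first.
  apply/measurable_EFinP; apply: measurable_funM.
    by apply: measurable_funTS; exact: measurable_powR.
  apply: measurable_funTS; apply: continuous_measurable_fun => x.
  by apply: continuous_comp; [exact: continuousN|exact: continuous_expR].
have imsqr : (fun x : R => x ^+ 2) @` `]0, +oo[ = `]0, +oo[%classic.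
  apply/seteqP; split => [_ [x /= + <-]|x /=]; rewrite !in_itv/= !andbT.
    by move=> x0; rewrite exprn_gt0.
  by move=> x0; exists (Num.sqrt x); rewrite ?sqr_sqrtr ?ltW//= in_itv/= sqrtr_gt0 x0.
pose G (t : R) := t `^ (1 / 2 - 1) * expR (- t).
have := @ge0_integral_image R _ _ _ (fun x => x ^+ 2) (fun x => 2 * x) G
  exhausted_itv0y.
rewrite imsqr => ->.
  have -> : Num.sqrt pi = 2 * (Num.sqrt pi / 2) :> R by field.
  suff -> : (\int[mu]_(x in `]0%R, +oo[) ((x ^+ 2) `^ (1 / 2 - 1) *
     expR (- x ^+ 2) * (2 * x))%:E = 2%:E * (Num.sqrt pi / 2)%:E)%E by [].
  rewrite -integral0y_gauss -integral_itv_obnd_cbnd; last first.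
    by apply/measurable_EFinP; apply: measurable_funTS; exact: measurable_gauss_fun.
  rewrite -ge0_integralZl//.
  - apply: eq_integral => x /[!inE]/=; rewrite in_itv/= andbT => x0.
    rewrite -EFinM /gauss_fun; congr EFin.
    have -> : 1 / 2 - 1 = - 2^-1 :> R by field.
    rewrite powRN powR12_sqrt ?sqr_ge0// sqrtr_sqr gtr0_norm//.
    by field; rewrite gt_eqF.
  - by apply/measurable_EFinP; apply: measurable_funTS; exact: measurable_gauss_fun.
  - by move=> x _; rewrite lee_fin gauss_fun_ge0.
move=> x /=; rewrite in_itv/= andbT => x0; split.
- by apply: is_derive_eq; rewrite /GRing.scale/=; ring.
- by rewrite mulr_gt0.
- by apply: continuousM; [exact: cst_continuous|exact: cvg_id].
- apply: continuousM; first by apply: continuous_powR_gt0; rewrite exprn_gt0.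
  by apply: continuous_comp; [exact: continuousN|exact: continuous_expR].
- by rewrite mulr_ge0 ?powR_ge0 ?expR_ge0.
Qed.

End gamma_half.

Section wallis.
Context {R : realType}.
Notation mu := (@lebesgue_measure R).

Lemma continuous_itv_integrable (f : R -> R) (a b : R) : continuous f ->
  mu.-integrable `[a, b] (EFin \o f).
Proof.
move=> cf; apply: continuous_compact_integrable; first exact: segment_compact.
exact: continuous_subspaceT.
Qed.

Lemma continuous_sinX n : continuous (fun x : R => sin x ^+ n).
Proof.
move=> x; apply: (@continuous_comp _ _ _ sin (fun y : R => y ^+ n)).
  exact: continuous_sin.
exact: exprn_continuous.
Qed.

(** The derivative of [sin ^+ (2n+1) * cos] is the difference of the two
    integrands, and this function vanishes at both ends. *)
Lemma wallis_rec n :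
  (n.*2.+2)%:R * \int[mu]_(x in `[0, pi / 2]) sin x ^+ n.+1.*2 =
  (n.*2.+1)%:R * \int[mu]_(x in `[0, pi / 2]) sin x ^+ n.*2 :> R.
Proof.
pose F (x : R) := sin x ^+ n.*2.+1 * cos x.
pose f (x : R) := (n.*2.+1)%:R * sin x ^+ n.*2 - (n.*2.+2)%:R * sin x ^+ n.+1.*2.
have cfZ c m : continuous (fun x : R => c * sin x ^+ m).
  by move=> x; apply: cvgM; [exact: cvg_cst|exact: continuous_sinX].
have dF (x : R) : is_derive x 1 F (f x).
  have -> : F = (sin ^+ n.*2.+1) * cos by apply/funext => y; rewrite !fctE.
  apply: is_derive_eq; rewrite /GRing.scale/= /f doubleS !fctE.
  have c2 := cos2sin2 x; rewrite [in LHS]mulrCA -expr2 c2 !exprS -[(n.*2.+2)%:R]natr1; ring.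
have cF : continuous F by move=> x; exact: is_derive_continuous (dF x).
have := @continuous_FTC2 R f F 0 (pi / 2).
have -> : F (pi / 2) = 0 by rewrite /F cos_pihalf mulr0.
have -> : F 0 = 0 by rewrite /F sin0 expr0n mul0r.
rewrite subee// => FTC; apply/eqP; rewrite eq_sym -subr_eq0; apply/eqP.
rewrite -!RintegralZl//; do ?exact/continuous_itv_integrable/continuous_sinX.
rewrite -RintegralB//; do ?exact/continuous_itv_integrable/cfZ.
rewrite /Rintegral FTC//.
- by rewrite divr_gt0 ?pi_gt0.
- by apply: continuous_subspaceT => x; apply: cvgB; exact: cfZ.
- split; [by move=> x _; case: (dF x)| |].
  + by apply: cvg_at_right_filter; exact: cF.
  + by apply: cvg_at_left_filter; exact: cF.
- by move=> x _; rewrite derive1E; case: (dF x).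
Qed.

Lemma pochhammerS (x : R) n : pochhammer x n.+1 = pochhammer x n * (x + n%:R).
Proof. by rewrite /pochhammer big_ord_recr. Qed.

Lemma pochhammer_gt0 (x : R) n : 0 < x -> 0 < pochhammer x n.
Proof. by move=> x0; apply: prodr_gt0 => i _; rewrite ltr_wpDr. Qed.

Lemma pochhammer1 n : pochhammer (1 : R) n = n`!%:R.
Proof.
elim: n => [|n IH]; first by rewrite /pochhammer big_ord0.
by rewrite pochhammerS IH addrC natr1 -natrM mulnC.
Qed.

Lemma wallis n : \int[mu]_(x in `[0, pi / 2]) sin x ^+ n.*2 =
  pi / 2 * (pochhammer (1 / 2) n / pochhammer 1 n) :> R.
Proof.
elim: n => [|n IH].
  under eq_Rintegral do rewrite expr0.
  rewrite Rintegral_cst// /pochhammer !big_ord0 divr1 mulr1 mul1r.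
  rewrite /= lebesgue_measure_itv/=.
  by rewrite lte_fin divr_gt0 ?pi_gt0//= oppr0 addr0.
have := wallis_rec n; rewrite IH !pochhammerS => E.
have p1 : pochhammer (1 : R) n != 0 by rewrite gt_eqF ?pochhammer_gt0.
have n1 : (1 + n%:R : R) != 0 by rewrite gt_eqF// ltr_wpDr.
apply: (@mulfI _ (n.*2.+2)%:R); first by rewrite pnatr_eq0.
have h1 : (n.*2.+1)%:R = 2 * n%:R + 1 :> R by rewrite -natr1 -muln2 natrM mulrC.
rewrite E -[(n.*2.+2)%:R]natr1 h1.
by field; rewrite p1 n1.
Qed.

End wallis.

Section arcsine.
Context {R : realType}.
Notation mu := (@lebesgue_measure R).

(** Euler's kernel for [alpha = 1/2] and [gamma = 1]: up to the factor [pi],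
    the density of the arcsine law. *)
Definition arcsine (u : R) := u `^ (1 / 2 - 1) * (1 - u) `^ (1 - 1 / 2 - 1).

Lemma arcsineE (u : R) : 0 <= u -> u <= 1 ->
  arcsine u = (Num.sqrt u * Num.sqrt (1 - u))^-1.
Proof.
move=> u0 u1; rewrite /arcsine.
have -> : 1 - 1 / 2 - 1 = - 2^-1 :> R by field.
have -> : 1 / 2 - 1 = - 2^-1 :> R by field.
by rewrite !powRN !powR12_sqrt ?invfM ?subr_ge0.
Qed.

Lemma arcsine_ge0 (u : R) : 0 <= arcsine u.
Proof. by rewrite mulr_ge0 ?powR_ge0. Qed.

Lemma continuous_arcsine (u : R) : u \in `]0, 1[ -> {for u, continuous arcsine}.
Proof.
rewrite in_itv/= => /andP[u0 u1].
have c1 : {for u, continuous (fun v : R => 1 - v)}.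
  by apply: continuousB; [exact: cst_continuous|exact: cvg_id].
apply: cvgM; first exact: continuous_powR_gt0.
have c2 : {for 1 - u, continuous (fun v : R => v `^ (1 - 1 / 2 - 1))}.
  by apply: continuous_powR_gt0; rewrite subr_gt0.
exact: (continuous_comp c1 c2).
Qed.

Lemma measurable_arcsine : measurable_fun setT arcsine.
Proof.
apply: measurable_funM; first exact: measurable_powR.
apply: (measurableT_comp (measurable_powR _)).
by apply: measurable_funB => //; exact: measurable_id.
Qed.

(** With [u = sin x ^+ 2] the kernel becomes the constant 2, which leaves
    Wallis' integral.  These moments are the ratios of Pochhammer symbols that
    couple the summation indices in the series of [F_D]. *)
Lemma integral_arcsine_moment n :
  (\int[mu]_(u in `[0%R, 1%R]) (arcsine u * u ^+ n)%:E =
   (pi * (pochhammer (1 / 2) n / pochhammer 1 n))%:E)%E.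
Proof.
have pi2 : 0 < pi / 2 :> R by rewrite divr_gt0 ?pi_gt0.
have := @ge0_integral_subst_improper R (fun x => sin x ^+ 2)
  (fun x => 2 * sin x * cos x) (fun u => arcsine u * u ^+ n)
  (fun x => 2 * sin x ^+ n.*2) 0 (pi / 2) pi2.
rewrite sin0 sin_pihalf expr0n expr1n/= => ->.
- have c2 : continuous (fun x : R => 2 * sin x ^+ n.*2).
    by move=> x; apply: cvgM; [exact: cvg_cst|exact: continuous_sinX].
  rewrite -[LHS]fineK; last first.
    by apply: integrable_fin_num => //; exact: continuous_itv_integrable c2.
  rewrite -/(Rintegral _ _ _).
  congr EFin; rewrite RintegralZl//; last exact/continuous_itv_integrable/continuous_sinX.
  by rewrite wallis; field; rewrite gt_eqF// pochhammer_gt0.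
- by apply: continuous_subspaceT; exact: continuous_sinX.
- move=> x; rewrite in_itv/= => /andP[x0 xp].
  have s0 : 0 < sin x by rewrite sin_gt0_pihalf// x0.
  have c0 : 0 < cos x by rewrite cos_gt0_pihalf// xp (lt_trans _ x0)// oppr_lt0.
  split; first by apply: is_derive_eq; rewrite /GRing.scale/=; ring.
  + by rewrite !mulr_gt0.
  + by apply: continuousM; [apply: continuousM; [exact: cst_continuous|]|];
      [exact: continuous_sin|exact: continuous_cos].
- move=> u u01; split.
    by apply: continuousM; [exact: continuous_arcsine|exact: exprn_continuous].
  move: u01; rewrite in_itv/= => /andP[u0 _].
  by rewrite mulr_ge0 ?arcsine_ge0// exprn_ge0// ltW.
- by apply: continuous_subspaceT => x;
    apply: cvgM; [exact: cvg_cst|exact: continuous_sinX].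
- move=> x; rewrite in_itv/= => /andP[x0 xp].
  have s0 : 0 < sin x by rewrite sin_gt0_pihalf// x0.
  have c0 : 0 < cos x by rewrite cos_gt0_pihalf// xp (lt_trans _ x0)// oppr_lt0.
  have c2 : 1 - sin x ^+ 2 = cos x ^+ 2 by rewrite -(cos2Dsin2 x) addrK.
  have s2 : sin x ^+ 2 <= 1 by rewrite -subr_ge0 c2 sqr_ge0.
  rewrite arcsineE ?sqr_ge0//.
  rewrite c2 !sqrtr_sqr !gtr0_norm// -exprM mul2n.
  by field; rewrite !gt_eqF.
Qed.

Lemma integrable_arcsine : mu.-integrable `[0, 1] (EFin \o arcsine).
Proof.
apply/integrableP; split.
  by apply/measurable_EFinP; apply: measurable_funTS; exact: measurable_arcsine.
have := integral_arcsine_moment 0.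
under eq_integral do rewrite expr0 mulr1.
under [X in (X < _)%E]eq_integral do rewrite /= ger0_norm ?arcsine_ge0//.
by move=> ->; rewrite ltry.
Qed.

End arcsine.

(** * The binomial series *)

Section binomial_series.
Context {R : realType}.

Definition binomial_coef (beta : R) (m : nat) := pochhammer beta m / m`!%:R.

Definition binomial_sum (beta : R) (M : nat) (x : R) :=
  \sum_(m < M) binomial_coef beta m * x ^+ m.

Lemma binomial_coefS (beta : R) m :
  m.+1%:R * binomial_coef beta m.+1 = (beta + m%:R) * binomial_coef beta m.
Proof.
rewrite /binomial_coef pochhammerS factS natrM.
by field; rewrite nat1r !pnatr_eq0 -lt0n fact_gt0.
Qed.

Lemma binomial_coef_le1 (beta : R) m : `|beta| <= 1 -> `|binomial_coef beta m| <= 1.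
Proof.
move=> beta1; rewrite normrM normfV normr_nat ler_pdivrMr ?mul1r ?ltr0n ?fact_gt0//.
rewrite -pochhammer1 /pochhammer normr_prod ler_prod// => i _.
by rewrite normr_ge0 (le_trans (ler_normD _ _))// normr_nat lerD2r.
Qed.

Lemma sum_expr_le (r : R) M : 0 <= r < 1 -> \sum_(m < M) r ^+ m <= (1 - r)^-1.
Proof.
move=> /andP[r0 r1]; have r1' : 0 < 1 - r by rewrite subr_gt0.
rewrite -(ler_pM2l r1') divff ?gt_eqF//.
rewrite -[1 - r]opprB mulNr -subrX1 opprB gerBl exprn_ge0//.
Qed.

Lemma binomial_sum_bounded (beta r x : R) M : `|beta| <= 1 -> `|x| <= r -> r < 1 ->
  `|binomial_sum beta M x| <= (1 - r)^-1.
Proof.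
move=> beta1 xr r1; have r0 : 0 <= r by rewrite (le_trans _ xr).
apply: le_trans (sum_expr_le M _); last by rewrite r0.
apply: le_trans (ler_norm_sum _ _ _) _; apply: ler_sum => m _.
rewrite normrM -[leRHS]mul1r ler_pM// ?binomial_coef_le1// normrX.
by rewrite lerXn2r// nnegrE.
Qed.

(** With [q ^+ 2 = r], one factor [q ^+ M] of [r ^+ M] compensates [M]: the
    product [M * q ^+ M] is at most the geometric series of ratio [q]. *)
Lemma cvg_natrM_expr (r : R) : 0 <= r < 1 -> (M%:R * r ^+ M) @[M --> \oo] --> (0 : R).
Proof.
move=> /andP[r0 r1]; pose q := Num.sqrt r.
have q0 : 0 <= q by rewrite sqrtr_ge0.
have qE : q ^+ 2 = r by rewrite sqr_sqrtr.
have q1 : q < 1 by rewrite -(@ltr_pXn2r _ 2)// ?nnegrE// qE expr1n.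
have le M : M%:R * r ^+ M <= (1 - q)^-1 * q ^+ M.
  rewrite -qE -exprM mulnC exprM expr2 mulrA ler_wpM2r ?exprn_ge0//.
  apply: le_trans (sum_expr_le M _); last by rewrite q0.
  (* compare term by term: q ^+ M <= q ^+ i for i < M *)
  have -> : M%:R * q ^+ M = \sum_(i < M) q ^+ M.
    by rewrite sumr_const card_ord mulr_natl.
  by apply: ler_sum => i _; apply: ler_wiXn2l => //; [exact: ltW|exact: ltnW].
apply: (@squeeze_cvgr _ _ _ _ (cst 0) (fun M : nat => (1 - q)^-1 * q ^+ M)).
- by apply: nearW => M; rewrite mulr_ge0 ?exprn_ge0//= le.
- exact: cvg_cst.
- rewrite -[X in _ --> X](mulr0 (1 - q)^-1); apply: cvgM; first exact: cvg_cst.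
  by apply: cvg_expr; rewrite ger0_norm.
Qed.

(** The recurrence of the coefficients makes the derivative telescope: only
    the contribution of the last term survives. *)
Lemma is_derive_binomial_sum (beta x : R) M : x < 1 ->
  is_derive x 1 (fun y => binomial_sum beta M y * (1 - y) `^ beta)
    (- (M%:R * binomial_coef beta M * x ^+ M.-1 * (1 - x) `^ (beta - 1))).
Proof.
move=> x1; have x1' : 0 < 1 - x by rewrite subr_gt0.
have dp : is_derive x 1 (fun y : R => (1 - y) `^ beta)
    (- (beta * (1 - x) `^ (beta - 1))).
  have d1 : is_derive x 1 (fun y : R => 1 - y) (- 1).
    by apply: is_derive_eq; rewrite add0r mul1r.
  have := @is_derive1_comp R (fun z => z `^ beta) (fun y => 1 - y) x _ _
    (is_derive1_powR beta x1') d1.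
  by rewrite mulrN1.
have pE : (1 - x) `^ beta = (1 - x) * (1 - x) `^ (beta - 1).
  rewrite -[X in X * _ `^ _]powRr1 ?ltW// -powRD; first by congr powR; ring.
  by rewrite (gt_eqF x1')/= implybT.
elim: M => [|M IH].
  have -> : (fun y => binomial_sum beta 0 y * (1 - y) `^ beta) = cst 0.
    by apply/funext => y; rewrite /binomial_sum big_ord0 mul0r.
  by rewrite !mul0r oppr0; exact: is_derive_cst.
have -> : (fun y => binomial_sum beta M.+1 y * (1 - y) `^ beta) =
    (fun y => binomial_sum beta M y * (1 - y) `^ beta) +
    (binomial_coef beta M) *: ((@GRing.exp R)^~ M * (fun y => (1 - y) `^ beta)).
  apply/funext => y; rewrite !fctE /binomial_sum big_ord_recr/= mulrDl.
  by rewrite /GRing.scale/= mulrA.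
have dX : is_derive x 1 ((@GRing.exp R)^~ M) (M%:R * x ^+ M.-1).
  have := is_deriveX M (is_derive_id x 1).
  have -> : (id : R -> R) ^+ M = ((@GRing.exp R)^~ M) by apply/funext=> y; rewrite fctE.
  by rewrite /GRing.scale/= mulr1.
have dXp := is_deriveZ (binomial_coef beta M) (is_deriveM dX dp).
apply: (is_derive_eq (is_deriveD IH dXp)); rewrite /GRing.scale/=.
rewrite binomial_coefS pE.
case: M {IH dX dXp} => [|M]/=; last rewrite exprS; ring.
Qed.

(** The product of the partial sum with [(1 - x) `^ beta] equals 1 at 0, and by
    the mean value theorem it varies between 0 and [x] by at most a constant
    times [M * `|x| ^+ M], which tends to 0. *)
Lemma cvg_binomial_sum (beta x : R) : `|beta| <= 1 -> `|x| < 1 ->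
  binomial_sum beta M x @[M --> \oo] --> ((1 - x) `^ beta)^-1.
Proof.
move=> beta1 x1; set r := `|x|.
have r0 : 0 <= r by exact: normr_ge0.
have xr : - r <= x <= r by rewrite -ler_norml.
have xlt1 : x < 1 by rewrite (le_lt_trans _ x1)// ler_norm.
pose f M y := binomial_sum beta M y * (1 - y) `^ beta.
(* since beta <= 1, the factor (1 - y) `^ (beta - 1) is largest at y = r *)
pose K := ((1 - r) `^ (1 - beta))^-1.
have dfK M y : `|y| <= r ->
    `|- (M%:R * binomial_coef beta M * y ^+ M.-1 * (1 - y) `^ (beta - 1))| <=
    M%:R * r ^+ M.-1 * K.
  move=> yr.
  have c1 : `|binomial_coef beta M| <= 1 by exact: binomial_coef_le1.
  have y1 : `|y ^+ M.-1| <= r ^+ M.-1 by rewrite normrX lerXn2r// nnegrE.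
  have ry : 1 - r <= 1 - y by rewrite lerD2l lerN2 (le_trans (ler_norm _)).
  have r1 : 0 < 1 - r by rewrite subr_gt0.
  have beta1' : 0 <= 1 - beta by rewrite subr_ge0 (le_trans (ler_norm _)).
  have p1 : `|(1 - y) `^ (beta - 1)| <= K.
    rewrite ger0_norm ?powR_ge0// -[beta - 1]opprB powRN.
    rewrite lef_pV2 ?posrE ?powR_gt0 ?(lt_le_trans r1)//.
    apply: ge0_ler_powR => //; rewrite nnegrE; first exact: ltW.
    exact: le_trans (ltW r1) ry.
  move: (binomial_coef beta M) c1 => c c1.
  rewrite normrN !normrM normr_nat ler_pM ?mulr_ge0//.
  by rewrite ler_pM ?mulr_ge0// ler_piMr.
have mvt M a b : a < b -> - r <= a -> b <= r ->
    `|f M b - f M a| <= M%:R * r ^+ M.-1 * K * (b - a).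
  move=> ab ra br.
  have absr y : y \in `[a, b] -> `|y| <= r.
    rewrite in_itv/= ler_norml => /andP[ay yb].
    by rewrite (le_trans ra ay) (le_trans yb br).
  have ylt1 y : y \in `[a, b] -> y < 1.
    by move=> /absr yr; rewrite (le_lt_trans (ler_norm _))// (le_lt_trans yr).
  have dfM y : y \in `[a, b] -> is_derive y 1 (f M)
      (- (M%:R * binomial_coef beta M * y ^+ M.-1 * (1 - y) `^ (beta - 1))).
    by move=> /ylt1; exact: is_derive_binomial_sum.
  have cfM : {within `[a, b], continuous (f M)}.
    apply: continuous_in_subspaceT => y /[!inE] /dfM.
    exact: is_derive_continuous.
  have [y yab ->] := MVT ab (fun y yab => dfM y (subset_itv_oo_cc yab)) cfM.
  rewrite normrM (gtr0_norm (_ : 0 < b - a)) ?subr_gt0// ler_wpM2r ?subr_ge0 ?(ltW ab)//.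
  by apply: dfK; apply: absr; apply: subset_itv_oo_cc yab.
have fx M : `|f M x - f M 0| <= M%:R * r ^+ M * K.
  case: M => [|M].
    by rewrite /f /binomial_sum !big_ord0 !mul0r subrr normr0.
  have rE : M.+1%:R * r ^+ M * K * r = M.+1%:R * r ^+ M.+1 * K by rewrite exprS; ring.
  have [x0|x0|<-] := ltgtP 0 x.
  - rewrite -rE; have rx : r = x - 0 by rewrite subr0 /r gtr0_norm.
    by rewrite [X in _ <= _ * X]rx mvt//; [rewrite oppr_le0|case/andP: xr].
  - rewrite -rE distrC; have rx : r = 0 - x by rewrite sub0r /r ltr0_norm.
    by rewrite [X in _ <= _ * X]rx mvt//; case/andP: xr.
  - by rewrite subrr normr0 !mulr_ge0 ?exprn_ge0// invr_ge0 powR_ge0.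
have f0 M : (0 < M)%N -> f M 0 = 1.
  case: M => // M _; rewrite /f /binomial_sum big_ord_recl/= big1 => [|i _].
    by rewrite subr0 powR1 /binomial_coef /pochhammer big_ord0 fact0 expr0; field.
  by rewrite exprS mul0r mulr0.
have cvgf : f M x @[M --> \oo] --> (1 : R).
  have cvgK : (M%:R * r ^+ M * K) @[M --> \oo] --> (0 : R).
    rewrite -[X in _ --> X](mul0r K); apply: cvgM; last exact: cvg_cst.
    by apply: cvg_natrM_expr; rewrite r0.
  apply/cvgrPdist_le => e e0; near=> M.
  rewrite -(f0 M)//; last by near: M; exists 1.
  rewrite distrC (le_trans (fx M))//.
  have : `|0 - M%:R * r ^+ M * K| <= e by near: M; move/cvgrPdist_le : cvgK; exact.
  by rewrite sub0r normrN; apply: le_trans; exact: ler_norm.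
have p0 : (1 - x) `^ beta != 0 by rewrite gt_eqF// powR_gt0// subr_gt0.
have -> : (fun M => binomial_sum beta M x) = (fun M => f M x * ((1 - x) `^ beta)^-1).
  by apply/funext => M; rewrite /f mulfK.
rewrite -[X in _ --> X]mul1r; apply: cvgM => //; exact: cvg_cst.
Unshelve. all: by end_near. Qed.

End binomial_series.

(** * Euler's integral for the Lauricella series *)

Section lauricella.
Context {R : realType}.
Notation mu := (@lebesgue_measure R).

Lemma integrable_arcsineX n :
  mu.-integrable `[0, 1] (fun u : R => (arcsine u * u ^+ n)%:E).
Proof.
apply: (le_integrable _ _ _ integrable_arcsine) => //.
  apply/measurable_EFinP/measurable_funTS; apply: measurable_funM.
    exact: measurable_arcsine.
  exact: exprn_measurable.
move=> u /=; rewrite in_itv/= => /andP[u0 u1].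
by rewrite lee_fin normrM ler_piMr// ger0_norm ?exprn_ge0// exprn_ile1.
Qed.

(** The indices interact only through the moment of order [\sum_j m j] of the
    arcsine kernel; the rest of the term is a product over [j]. *)
Lemma lauricella_term_moment n (beta x : n.-tuple R) (m : 'I_n -> nat) :
  lauricella_term (1 / 2) beta 1 x m = pi^-1 *
    (\prod_(j < n) (binomial_coef (tnth beta j) (m j) * tnth x j ^+ m j) *
     \int[mu]_(u in `[0, 1]) (arcsine u * u ^+ (\sum_(j < n) m j)%N)).
Proof.
rewrite /lauricella_term /Rintegral integral_arcsine_moment/=.
rewrite /binomial_coef big_split/= prodf_div.
have p0 : (pi : R) != 0 by rewrite gt_eqF ?pi_gt0.
have f0 : \prod_(j < n) (m j)`!%:R != 0 :> R.
  by apply/prodf_neq0 => j _; rewrite pnatr_eq0 -lt0n fact_gt0.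
have q0 N : pochhammer (1 : R) N != 0 by rewrite gt_eqF ?pochhammer_gt0.
move: (pi : R) p0 => p p0.
by field; rewrite p0 f0 q0.
Qed.

(** Under the integral sign the sum over a cube factors into a product of
    one-variable binomial sums, by distributivity.  The integrability of this
    product is what dominated convergence needs later. *)
Lemma lauricella_cube_sum n (beta x : n.-tuple R) M :
  mu.-integrable `[0, 1] (fun u : R => (arcsine u *
      \prod_(j < n) binomial_sum (tnth beta j) M (tnth x j * u))%:E) /\
  \sum_(m : {ffun 'I_n -> 'I_M})
    lauricella_term (1 / 2) beta 1 x (fun j => m j : nat) =
  pi^-1 * \int[mu]_(u in `[0, 1]) (arcsine u *
      \prod_(j < n) binomial_sum (tnth beta j) M (tnth x j * u)).
Proof.
pose k (m : {ffun 'I_n -> 'I_M}) :=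
  \prod_(j < n) (binomial_coef (tnth beta j) (m j) * tnth x j ^+ m j).
pose N (m : {ffun 'I_n -> 'I_M}) := (\sum_(j < n) m j)%N.
have E u : (arcsine u *
      \prod_(j < n) binomial_sum (tnth beta j) M (tnth x j * u))%:E =
    (\sum_(m : {ffun 'I_n -> 'I_M}) (k m)%:E * (arcsine u * u ^+ N m)%:E)%E.
  under [in RHS]eq_bigr do rewrite -EFinM.
  rewrite sumEFin; congr EFin.
  rewrite /binomial_sum bigA_distr_bigA/= mulr_sumr; apply: eq_bigr => m _.
  rewrite mulrCA; congr *%R; rewrite /k /N expr_sum -big_split/=.
  by apply: eq_bigr => j _; rewrite exprMn mulrA.
have ik m : mu.-integrable `[0, 1] (fun u => (k m)%:E * (arcsine u * u ^+ N m)%:E)%E.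
  exact/integrableZl/integrable_arcsineX.
split.
  by rewrite (funext E); apply: integrable_sum => // m _; exact: ik.
rewrite /Rintegral; under eq_integral do rewrite E.
rewrite integral_sum//.
rewrite (eq_bigr (fun m => (k m * (pi *
    (pochhammer (1 / 2) (N m) / pochhammer 1 (N m))))%:E)); last first.
  move=> m _; rewrite integralZl//; last exact: integrable_arcsineX.
  by rewrite integral_arcsine_moment -EFinM.
rewrite sumEFin/= mulr_sumr; apply: eq_bigr => m _.
by rewrite lauricella_term_moment /Rintegral integral_arcsine_moment.
Qed.

Lemma lauricella_integral_arcsine n (beta x : n.-tuple R) :
  lauricella_integral (1 / 2) beta 1 x = pi^-1 * \int[mu]_(u in `[0, 1])
    (arcsine u * \prod_(j < n) ((1 - tnth x j * u) `^ tnth beta j)^-1).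
Proof.
rewrite /lauricella_integral (_ : 1 - 1 / 2 = 1 / 2 :> R); last by field.
rewrite Gamma1 Gamma_half -expr2 sqr_sqrtr ?pi_ge0// [1 / pi]div1r.
congr *%R; apply: eq_Rintegral => u _.
by rewrite prodfV /arcsine (_ : 1 - 1 / 2 = 1 / 2 :> R)//; field.
Qed.

(** Euler's integral representation inside the polydisc: dominated convergence
    applies because the binomial sums at [x_j * u] are bounded by
    [(1 - `|x_j|)^-1] uniformly in [u] and in their length. *)
Lemma lauricella_series_integral n (beta x : n.-tuple R) :
  (forall j, `|tnth beta j| <= 1) -> (forall j, `|tnth x j| < 1) ->
  lauricella_series (1 / 2) beta 1 x = lauricella_integral (1 / 2) beta 1 x.
Proof.
move=> beta1 x1; rewrite lauricella_integral_arcsine.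
pose g M u := arcsine u *
  \prod_(j < n) binomial_sum (tnth beta j) M (tnth x j * u).
pose h u := arcsine u * \prod_(j < n) ((1 - tnth x j * u) `^ tnth beta j)^-1.
pose C := \prod_(j < n) (1 - `|tnth x j|)^-1.
have xu j u : u \in `[0, 1] -> `|tnth x j * u| <= `|tnth x j|.
  rewrite in_itv/= => /andP[u0 u1].
  by rewrite normrM ler_piMr// ger0_norm.
have mg M : measurable_fun `[(0 : R), 1] (EFin \o g M).
  exact: measurable_int (lauricella_cube_sum beta x M).1.
have gh u : u \in `[0, 1] -> g M u @[M --> \oo] --> h u.
  move=> u01; apply: cvgM; first exact: cvg_cst.
  apply: cvg_big => [|j _]; first exact: mul_continuous.
  apply: cvg_binomial_sum => //; exact: le_lt_trans (xu j u u01) (x1 j).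
have gC M u : u \in `[0, 1] -> `|g M u| <= arcsine u * C.
  move=> u01; rewrite normrM ger0_norm ?arcsine_ge0// ler_wpM2l ?arcsine_ge0//.
  rewrite normr_prod ler_prod// => j _; rewrite normr_ge0/=.
  by apply: binomial_sum_bounded => //; exact: xu.
have ghE (u : R) : `[0, 1]%classic u -> (EFin \o g M) u @[M --> \oo] --> (h u)%:E.
  by move=> u01; apply: cvg_EFin; [exact: nearW|exact: gh].
have [||||ih _ cvgI] := @dominated_convergence _ _ R mu `[(0 : R), 1]%classic (measurable_itv _)
  (fun M => EFin \o g M) (EFin \o h) (fun u => (C%:E * (arcsine u)%:E)%E) mg.
- apply: (@emeasurable_fun_cvg _ _ _ _ _ _ mg); exact: ghE.
- exact/aeW/ghE.
- exact/integrableZl/integrable_arcsine.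
- by apply: aeW => u M u01; rewrite -EFinM lee_fin mulrC gC.
rewrite /lauricella_series; apply/cvg_lim => //.
under eq_fun do rewrite (lauricella_cube_sum beta x _).2.
apply: cvgM; first exact: cvg_cst.
apply: fine_cvg; rewrite fineK//; exact: integrable_fin_num.
Qed.

End lauricella.

(** * The complete elliptic integral *)

Section complete_elliptic.
Context {R : realType}.
Notation mu := (@lebesgue_measure R).

Lemma legendre_gt0 (k t : R) : `|k| < 1 -> 0 < 1 - k ^+ 2 * sin t ^+ 2.
Proof.
move=> k1; rewrite subr_gt0.
have k2 : k ^+ 2 < 1 by rewrite -real_normK ?num_real// expr_lt1.
have s2 : sin t ^+ 2 <= 1 by rewrite sin2cos2 gerBl sqr_ge0.
by rewrite (le_lt_trans _ k2)// ler_piMr ?sqr_ge0.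
Qed.

Lemma continuous_legendre (k : R) : `|k| < 1 ->
  continuous (fun t : R => (Num.sqrt (1 - k ^+ 2 * sin t ^+ 2))^-1).
Proof.
move=> k1 t; apply: cvgV; first by rewrite gt_eqF// sqrtr_gt0 legendre_gt0.
have c : (1 - k ^+ 2 * sin s ^+ 2) @[s --> t] --> 1 - k ^+ 2 * sin t ^+ 2.
  apply: cvgB; first exact: cvg_cst.
  by apply: cvgM; [exact: cvg_cst|exact: continuous_sinX].
by apply: (cvg_comp _ _ c); exact: sqrt_continuous.
Qed.

(** Legendre's trigonometric form, through [x = sin t]; its integrand is
    continuous, so that the integral is finite. *)
Lemma ellipticK_legendre (k : R) : `|k| < 1 ->
  ellipticK k = \int[mu]_(t in `[0, pi / 2])
    (Num.sqrt (1 - k ^+ 2 * sin t ^+ 2))^-1.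
Proof.
move=> k1; have pi2 : 0 < pi / 2 :> R by rewrite divr_gt0 ?pi_gt0.
rewrite /ellipticK /Rintegral; congr fine.
have := @ge0_integral_subst_improper R sin cos
  (fun x => (Num.sqrt ((1 - x ^+ 2) * (1 - k ^+ 2 * x ^+ 2)))^-1)
  (fun t => (Num.sqrt (1 - k ^+ 2 * sin t ^+ 2))^-1) 0 (pi / 2) pi2.
have cos0 x : x \in `]0, pi / 2[ -> 0 < cos x :> R.
  rewrite in_itv/= => /andP[x0 xp].
  by rewrite cos_gt0_pihalf// xp (lt_trans _ x0)// oppr_lt0.
rewrite sin0 sin_pihalf; apply.
- by apply: continuous_subspaceT; exact: continuous_sin.
- by move=> x /cos0 c0; split; [exact: is_derive_sin|exact: c0|exact: continuous_cos].
- move=> y; rewrite in_itv/= => /andP[y0 y1]; split; last first.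
    by rewrite invr_ge0 sqrtr_ge0.
  have y2 : 0 < 1 - y ^+ 2 by rewrite subr_gt0 expr_lt1// ltW.
  have k2 : k ^+ 2 < 1 by rewrite -real_normK ?num_real// expr_lt1.
  have ky2 : 0 < 1 - k ^+ 2 * y ^+ 2.
    rewrite subr_gt0 (le_lt_trans _ k2)// ler_piMr ?sqr_ge0//.
    by rewrite -subr_ge0 ltW.
  apply: cvgV; first by rewrite gt_eqF// sqrtr_gt0 mulr_gt0.
  have c : ((1 - s ^+ 2) * (1 - k ^+ 2 * s ^+ 2)) @[s --> y] -->
      (1 - y ^+ 2) * (1 - k ^+ 2 * y ^+ 2).
    apply: cvgM; (apply: cvgB; first exact: cvg_cst).
      exact: exprn_continuous.
    by apply: cvgM; [exact: cvg_cst|exact: exprn_continuous].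
  by apply: (cvg_comp _ _ c); exact: sqrt_continuous.
- by apply: continuous_subspaceT; exact: continuous_legendre.
- move=> x /cos0 c0; rewrite -cos2sin2 sqrtrM ?sqr_ge0// sqrtr_sqr gtr0_norm//.
  by field; rewrite !gt_eqF// sqrtr_gt0 legendre_gt0.
Qed.

(** The integrand of Legendre's form is at least 1. *)
Lemma ellipticK_gt0 (k : R) : `|k| < 1 -> 0 < ellipticK k.
Proof.
move=> k1; have pi2 : 0 < pi / 2 :> R by rewrite divr_gt0 ?pi_gt0.
rewrite ellipticK_legendre//; apply: (lt_le_trans pi2).
have E : pi / 2 = \int[mu]_(t in `[0, pi / 2]) cst (1 : R) t.
  rewrite Rintegral_cst// mul1r /= lebesgue_measure_itv/=.
  by rewrite lte_fin pi2/= oppr0 addr0.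
rewrite [leLHS]E; apply: le_Rintegral => //.
- by apply: continuous_itv_integrable => x; exact: cvg_cst.
- exact/continuous_itv_integrable/continuous_legendre.
- move=> t _; rewrite /= invf_ge1 ?sqrtr_gt0 ?legendre_gt0//.
  rewrite -[leRHS]sqrtr1 ler_wsqrtr// gerBl mulr_ge0 ?sqr_ge0//.
Qed.

Lemma Rintegral_symmetric_itv (h : R -> R) (c : R) : 0 < c -> continuous h ->
  \int[mu]_(t in `[- c, c]) h t = \int[mu]_(t in `[0, c]) (h t + h (- t)).
Proof.
move=> c0 ch; have chN : continuous (h \o -%R).
  move=> t; apply: (@continuous_comp _ _ _ -%R h); last exact: ch.
  exact: continuousN.
rewrite RintegralD//; do ?exact: continuous_itv_integrable.
have <- : \int[mu]_(t in `[- c, 0]) h t = \int[mu]_(t in `[0, c]) h (- t).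
  rewrite /Rintegral -{1}[0]oppr0; congr fine.
  rewrite (@integration_by_substitution_oppr R h 0 c (ltW c0))//.
  exact: continuous_subspaceT.
have ih : mu.-integrable `[- c, c] (EFin \o h) by exact: continuous_itv_integrable.
have := @Rintegral_itvB R h (BLeft (- c)) (BRight c) 0 ih.
rewrite !bnd_simp oppr_le0 (ltW c0) => /(_ isT isT).
rewrite Rintegral_itv_obnd_cbnd.
  by move=> <-; rewrite subrK.
by apply: integrableS ih => //; apply: subset_itvr; rewrite bnd_simp oppr_le0 ltW.
Qed.

End complete_elliptic.

(** * Reduction of the hyperelliptic integral *)

Section reduction.
Context {R : realType} (a b : R).
Notation mu := (@lebesgue_measure R).
Hypotheses (a1 : 1 < a) (ab : a < b).

Let a0 : 0 < a. Proof. exact: lt_trans a1. Qed.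
Let b1 : 1 < b. Proof. exact: lt_trans ab. Qed.
Let b0 : 0 < b. Proof. exact: lt_trans b1. Qed.
Let a2 : 0 < a ^+ 2 - 1. Proof. by rewrite subr_gt0 exprn_egt1. Qed.
Let b2 : 0 < b ^+ 2 - 1. Proof. by rewrite subr_gt0 exprn_egt1. Qed.
Let a4 : 0 < a ^+ 4 - 1. Proof. by rewrite subr_gt0 exprn_egt1. Qed.
Let ab2 : 0 < b ^+ 2 - a ^+ 2. Proof. by rewrite subr_gt0 ltr_pXn2r// nnegrE ltW. Qed.
Let ab3 : 0 < a ^+ 2 * b ^+ 2 - 1.
Proof. by rewrite subr_gt0 -exprMn exprn_egt1// mulr_egt1. Qed.

Let k := b * (a ^+ 2 - 1) / (a * (b ^+ 2 - 1)).

Lemma modulus_lt1 : `|k| < 1.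
Proof.
rewrite gtr0_norm; last by rewrite divr_gt0 ?mulr_gt0.
rewrite ltr_pdivrMr ?mulr_gt0// mul1r -subr_gt0.
have -> : a * (b ^+ 2 - 1) - b * (a ^+ 2 - 1) = (b - a) * (1 + a * b) by ring.
by rewrite mulr_gt0 ?subr_gt0// ltr_wpDr ?mulr_ge0 ?ltW.
Qed.

Let x1 := 1 - a ^+ 4.
Let x2 := (a ^+ 4 - 1) * b ^+ 2 / (a ^+ 2 - b ^+ 2).
Let x3 := (a ^+ 4 - 1) / (a ^+ 2 * b ^+ 2 - 1).

(** The substitution.  The parameter [r = rpar t] solves [r - r^-1 = rdiff t],
    so that [r + r^-1 = rsum t], and runs from [a^-1] to [a] as [t] runs from
    [- pi / 2] to [pi / 2].  Replacing [t] by [- t] replaces [r] by [r^-1]: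
    this is the inversion of the coordinate [s = r ^+ 2].
    The Euler variable [upar t] is an affine function of [r ^+ 2]. *)
Definition rdiff (t : R) := (a - a^-1) * sin t.
Definition rsum (t : R) := Num.sqrt (rdiff t ^+ 2 + 4).
Definition rpar (t : R) := (rdiff t + rsum t) / 2.
Definition upar (t : R) := (a ^+ 2 * rpar t ^+ 2 - 1) / (a ^+ 4 - 1).
Definition dupar (t : R) :=
  2 * a ^+ 2 * rpar t ^+ 2 * ((a - a^-1) * cos t) / ((a ^+ 4 - 1) * rsum t).

Let w2gt0 t : 0 < rdiff t ^+ 2 + 4. Proof. by rewrite ltr_wpDl ?sqr_ge0. Qed.
Let w0 t : 0 < rsum t. Proof. by rewrite sqrtr_gt0. Qed.
Let w2 t : rsum t ^+ 2 = rdiff t ^+ 2 + 4. Proof. by rewrite sqr_sqrtr// ltW. Qed.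
Let r2 t : rpar t ^+ 2 = rdiff t * rpar t + 1.
Proof.
have -> : rpar t ^+ 2 = (rdiff t ^+ 2 + 2 * rdiff t * rsum t + rsum t ^+ 2) / 4.
  by rewrite /rpar; field.
by rewrite w2 /rpar; field.
Qed.
Let r0 t : 0 < rpar t.
Proof.
rewrite divr_gt0// -ltrBlDl sub0r; apply: (le_lt_trans (ler_norm _)).
by rewrite normrN -sqrtr_sqr ltr_sqrt// ltrDl.
Qed.

Let aV0 : 0 < a - a^-1.
Proof. by rewrite subr_gt0 (lt_trans _ a1)// invf_lt1. Qed.

Lemma is_derive_upar (t : R) : is_derive t 1 upar (dupar t).
Proof.
have dz : is_derive t 1 rdiff ((a - a^-1) * cos t).
  exact: is_derive_eq.
have dz2 : is_derive t 1 (fun s => rdiff s ^+ 2 + 4) (2 * rdiff t * ((a - a^-1) * cos t)).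
  by apply: is_derive_eq; rewrite /GRing.scale/=; ring.
have dw : is_derive t 1 rsum ((2 * rsum t)^-1 * (2 * rdiff t * ((a - a^-1) * cos t))).
  exact: (@is_derive1_comp R Num.sqrt (fun s => rdiff s ^+ 2 + 4) t _ _
    (is_derive1_sqrt (w2gt0 t)) dz2).
have dr : is_derive t 1 rpar (rpar t * ((a - a^-1) * cos t) / rsum t).
  apply: is_derive_eq; rewrite /GRing.scale/= /rpar; field.
  by rewrite !gt_eqF.
rewrite /upar; apply: is_derive_eq; rewrite /GRing.scale/= /dupar.
by field; rewrite !gt_eqF.
Qed.

Let C := 2 * Num.sqrt ((b ^+ 2 - a ^+ 2) * (a ^+ 2 * b ^+ 2 - 1))
  / (a * (b ^+ 2 - 1)).

Let kappa (t : R) := 1 - k ^+ 2 * sin t ^+ 2.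

Let kappa0 t : 0 < kappa t. Proof. exact/legendre_gt0/modulus_lt1. Qed.

Definition euler_integrand (u : R) := Num.sqrt (1 - x1 * u) /
  (Num.sqrt u * Num.sqrt (1 - u) * Num.sqrt (1 - x2 * u) * Num.sqrt (1 - x3 * u)).

(** Legendre's integrand for the modulus [k], times [C * r / (r + r^-1)]. *)
Definition pullback (t : R) := C * (rpar t / rsum t) / Num.sqrt (kappa t).

(** In the variable [r] the branch points become symmetric under the inversion
    of [r ^+ 2]. *)
Lemma upar_factors t : [/\ 1 - x1 * upar t = a ^+ 2 * rpar t ^+ 2,
  1 - upar t = a ^+ 2 * (a ^+ 2 - rpar t ^+ 2) / (a ^+ 4 - 1),
  1 - x2 * upar t = a ^+ 2 * (b ^+ 2 * rpar t ^+ 2 - 1) / (b ^+ 2 - a ^+ 2) &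
  1 - x3 * upar t = a ^+ 2 * (b ^+ 2 - rpar t ^+ 2) / (a ^+ 2 * b ^+ 2 - 1)].
Proof.
have n4 : a ^+ 4 - 1 != 0 by rewrite gt_eqF.
have n2 : b ^+ 2 - a ^+ 2 != 0 by rewrite gt_eqF.
have n2' : a ^+ 2 - b ^+ 2 != 0 by rewrite -oppr_eq0 opprB.
have n3 : a ^+ 2 * b ^+ 2 - 1 != 0 by rewrite gt_eqF.
have n3' : (a * b) ^+ 2 - 1 != 0 by rewrite exprMn.
by split; rewrite /x1 /x2 /x3 /upar; field; rewrite ?n4 ?n2 ?n2' ?n3 ?n3'.
Qed.

(** Two factors swapped by the inversion multiply to a function of
    [r - r^-1], up to the factor [r ^+ 2]. *)
Lemma rpar_pair_a t : (a ^+ 2 * rpar t ^+ 2 - 1) * (a ^+ 2 - rpar t ^+ 2) =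
  (rpar t * (a ^+ 2 - 1) * cos t) ^+ 2.
Proof.
rewrite [RHS]exprMn cos2sin2.
have -> : (a ^+ 2 * rpar t ^+ 2 - 1) * (a ^+ 2 - rpar t ^+ 2) =
   rpar t ^+ 2 * (a ^+ 2 - 1) ^+ 2 - a ^+ 2 * (rpar t ^+ 2 - 1) ^+ 2 by ring.
have -> : rpar t ^+ 2 - 1 = rdiff t * rpar t by rewrite r2; ring.
by rewrite /rdiff; field; rewrite gt_eqF.
Qed.

Lemma rpar_pair_b t : (b ^+ 2 * rpar t ^+ 2 - 1) * (b ^+ 2 - rpar t ^+ 2) =
  (rpar t * (b ^+ 2 - 1)) ^+ 2 * kappa t.
Proof.
have -> : (b ^+ 2 * rpar t ^+ 2 - 1) * (b ^+ 2 - rpar t ^+ 2) =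
   rpar t ^+ 2 * (b ^+ 2 - 1) ^+ 2 - b ^+ 2 * (rpar t ^+ 2 - 1) ^+ 2 by ring.
have -> : rpar t ^+ 2 - 1 = rdiff t * rpar t by rewrite r2; ring.
by rewrite /rdiff /kappa /k; field; rewrite !gt_eqF.
Qed.

Lemma upar_ends : upar (- (pi / 2)) = 0 /\ upar (pi / 2) = 1.
Proof.
have wE t : rdiff t ^+ 2 = (a - a^-1) ^+ 2 -> rsum t = a + a^-1.
  move=> zE; rewrite /rsum zE.
  have -> : (a - a^-1) ^+ 2 + 4 = (a + a^-1) ^+ 2 by field; rewrite gt_eqF.
  by rewrite sqrtr_sqr gtr0_norm// addr_gt0 ?invr_gt0.
have zp : rdiff (pi / 2) = a - a^-1 by rewrite /rdiff sin_pihalf mulr1.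
have zm : rdiff (- (pi / 2)) = - (a - a^-1) by rewrite /rdiff sinN sin_pihalf mulrN1.
rewrite /upar /rpar !wE ?zp ?zm ?sqrrN//.
by split; field; rewrite !gt_eqF.
Qed.

(** The first two factors have a positive product and a positive combination,
    so both are positive; the other two are larger since [a < b]. *)
Lemma rpar_factors_gt0 t : 0 < cos t ->
  [/\ 0 < a ^+ 2 * rpar t ^+ 2 - 1, 0 < a ^+ 2 - rpar t ^+ 2,
      0 < b ^+ 2 * rpar t ^+ 2 - 1 & 0 < b ^+ 2 - rpar t ^+ 2].
Proof.
move=> c0.
have PQ : 0 < (a ^+ 2 * rpar t ^+ 2 - 1) * (a ^+ 2 - rpar t ^+ 2).
  by rewrite rpar_pair_a exprn_gt0// mulr_gt0// mulr_gt0.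
have P0 : 0 < a ^+ 2 * rpar t ^+ 2 - 1.
  rewrite ltNge; apply/negP => P0.
  have Q0 : 0 < a ^+ 2 - rpar t ^+ 2.
    rewrite -(pmulr_rgt0 _ (exprn_gt0 2 a0)).
    have := a4; have -> : a ^+ 4 - 1 = (a ^+ 2 * rpar t ^+ 2 - 1) +
      a ^+ 2 * (a ^+ 2 - rpar t ^+ 2) by ring.
    by move/lt_le_trans; apply; rewrite gerDr.
  by move: PQ; rewrite pmulr_lgt0// ltNge P0.
have Q0 : 0 < a ^+ 2 - rpar t ^+ 2 by rewrite -(pmulr_rgt0 _ P0).
have lab : a ^+ 2 <= b ^+ 2 by rewrite -subr_ge0 ltW.
split => //.
  by rewrite (lt_le_trans P0)// lerD2r ler_wpM2r// sqr_ge0.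
by rewrite (lt_le_trans Q0)// lerD2r.
Qed.

(** By [upar_factors] and the two pair identities the product of the four
    radicals is the square root of [X ^+ 2 * kappa t / D], with a rational
    expression [X] in [r] and [cos t]. *)
Lemma euler_integrand_upar t : t \in `]- (pi / 2), pi / 2[ ->
  euler_integrand (upar t) * dupar t = pullback t.
Proof.
move=> tp; have c0 : 0 < cos t by apply: cos_gt0_pihalf; move: tp; rewrite in_itv.
have [P0 Q0 P0' Q0'] := rpar_factors_gt0 c0.
have [E1 E2 E3 E4] := upar_factors t.
have kap := kappa0 t; have rt := r0 t; have wt := w0 t.
pose D := (b ^+ 2 - a ^+ 2) * (a ^+ 2 * b ^+ 2 - 1).
have D0 : 0 < D by rewrite mulr_gt0.
pose X := a ^+ 3 * rpar t ^+ 2 * (a ^+ 2 - 1) * cos t * (b ^+ 2 - 1) / (a ^+ 4 - 1).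
have X0 : 0 < X.
  rewrite /X; move: (rpar t) rt => r rt.
  by rewrite divr_gt0 ?mulr_gt0 ?exprn_gt0.
have a2p : 0 < a ^+ 2 by rewrite exprn_gt0.
have den : Num.sqrt (upar t) * Num.sqrt (1 - upar t) * Num.sqrt (1 - x2 * upar t) *
    Num.sqrt (1 - x3 * upar t) = X * Num.sqrt (kappa t) / Num.sqrt D.
  have u0 : 0 < upar t by rewrite divr_gt0.
  have u1 : 0 < 1 - upar t by rewrite E2 divr_gt0 ?mulr_gt0.
  have u2 : 0 < 1 - x2 * upar t by rewrite E3 divr_gt0 ?mulr_gt0.
  have u01 : 0 < upar t * (1 - upar t) by exact: mulr_gt0.
  have u012 : 0 < upar t * (1 - upar t) * (1 - x2 * upar t) by exact: mulr_gt0.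
  rewrite -(sqrtrM _ (ltW u0)) -(sqrtrM _ (ltW u01)) -(sqrtrM _ (ltW u012)).
  have -> : upar t * (1 - upar t) * (1 - x2 * upar t) * (1 - x3 * upar t) =
      X ^+ 2 * kappa t / D.
    rewrite E2 E3 E4 /upar.
    transitivity (a ^+ 6 * ((a ^+ 2 * rpar t ^+ 2 - 1) * (a ^+ 2 - rpar t ^+ 2)) *
      ((b ^+ 2 * rpar t ^+ 2 - 1) * (b ^+ 2 - rpar t ^+ 2)) / ((a ^+ 4 - 1) ^+ 2 * D)).
      by rewrite /D; field; rewrite -?exprMn !gt_eqF// exprMn.
    by rewrite rpar_pair_a rpar_pair_b /X; field; rewrite !gt_eqF.
  have XK : 0 <= X ^+ 2 * kappa t by rewrite mulr_ge0 ?sqr_ge0// ltW.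
  by rewrite sqrtrM// sqrtrM ?sqr_ge0// sqrtr_sqr gtr0_norm// sqrtrV// ltW.
rewrite /euler_integrand den E1 -exprMn sqrtr_sqr (gtr0_norm (mulr_gt0 a0 rt)).
have sk : Num.sqrt (kappa t) != 0 by rewrite gt_eqF// sqrtr_gt0.
have sD : Num.sqrt D != 0 by rewrite gt_eqF// sqrtr_gt0.
rewrite /dupar /pullback /C -/D /X; move: sk sD.
move: (Num.sqrt (kappa t)) (Num.sqrt D) => sk sD sk0 sD0.
by field; rewrite sk0 sD0 !gt_eqF.
Qed.

Lemma continuous_sqrt_affine (x u : R) :
  {for u, continuous (fun u => Num.sqrt (1 - x * u))}.
Proof.
have c : (1 - x * s) @[s --> u] --> 1 - x * u.
  by apply: cvgB; [exact: cvg_cst|apply: cvgM; [exact: cvg_cst|exact: cvg_id]].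
by apply: (cvg_comp _ _ c); exact: sqrt_continuous.
Qed.

Lemma affine_gt0 (x u : R) : x < 1 -> 0 <= u <= 1 -> 0 < 1 - x * u.
Proof.
move=> x1' /andP[]; rewrite le_eqVlt => /predU1P[<-|u0] u1.
  by rewrite mulr0 subr0.
have -> : 1 - x * u = (1 - u) + u * (1 - x) by ring.
by rewrite ltr_wpDl ?subr_ge0// mulr_gt0// subr_gt0.
Qed.

Lemma x1_lt1 : x1 < 1. Proof. by rewrite gtrBl exprn_gt0. Qed.
Lemma x2_lt1 : x2 < 1.
Proof.
apply: (@le_lt_trans _ _ 0) => //; rewrite /x2 -[a ^+ 2 - b ^+ 2]opprB invrN mulrN oppr_le0.
by rewrite ltW// divr_gt0 ?mulr_gt0 ?exprn_gt0.
Qed.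
Lemma x3_lt1 : x3 < 1.
Proof.
rewrite ltr_pdivrMr// mul1r ltrD2r (_ : a ^+ 4 = a ^+ 2 * a ^+ 2); last by ring.
by rewrite ltr_pM2l ?exprn_gt0// -subr_gt0.
Qed.

Lemma continuous_euler_integrand u : u \in `]0, 1[ -> {for u, continuous euler_integrand}.
Proof.
rewrite in_itv/= => /andP[u0 u1].
have u01 : 0 <= u <= 1 by rewrite !ltW.
apply: cvgM; first exact: continuous_sqrt_affine.
apply: cvgV.
  have u2 := affine_gt0 x2_lt1 u01; have u3 := affine_gt0 x3_lt1 u01.
  by rewrite gt_eqF// !mulr_gt0 ?sqrtr_gt0// subr_gt0.
apply: cvgM; last exact: continuous_sqrt_affine.
apply: cvgM; last exact: continuous_sqrt_affine.
apply: cvgM; first exact: sqrt_continuous.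
have c : (1 - s) @[s --> u] --> 1 - u by apply: cvgB; [exact: cvg_cst|exact: cvg_id].
by apply: (cvg_comp _ _ c); exact: sqrt_continuous.
Qed.

Lemma continuous_rdiff : continuous rdiff.
Proof. by move=> t; apply: cvgM; [exact: cvg_cst|exact: continuous_sin]. Qed.

Lemma continuous_rsum : continuous rsum.
Proof.
move=> t; have c : (rdiff s ^+ 2 + 4) @[s --> t] --> rdiff t ^+ 2 + 4.
  by apply: cvgD; [apply: cvgM; exact: continuous_rdiff|exact: cvg_cst].
by apply: (cvg_comp _ _ c); exact: sqrt_continuous.
Qed.

Lemma continuous_rpar : continuous rpar.
Proof.
move=> t; apply: cvgM; last exact: cvg_cst.
by apply: cvgD; [exact: continuous_rdiff|exact: continuous_rsum].
Qed.

Lemma continuous_dupar : continuous dupar.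
Proof.
move=> t; apply: cvgM.
  apply: cvgM.
    apply: cvgM; first exact: cvg_cst.
    by apply: cvgM; exact: continuous_rpar.
  by apply: cvgM; [exact: cvg_cst|exact: continuous_cos].
apply: cvgV; first by rewrite gt_eqF// mulr_gt0.
by apply: cvgM; [exact: cvg_cst|exact: continuous_rsum].
Qed.

Lemma continuous_pullback : continuous pullback.
Proof.
move=> t; apply: cvgM; last exact/continuous_legendre/modulus_lt1.
apply: cvgM; first exact: cvg_cst.
apply: cvgM; first exact: continuous_rpar.
by apply: cvgV; [rewrite gt_eqF|exact: continuous_rsum].
Qed.

(** The two points exchanged by the involution contribute
    [r / (r + r^-1) + r^-1 / (r + r^-1) = 1]. *)
Lemma pullbackDN t : pullback t + pullback (- t) = C * (Num.sqrt (kappa t))^-1.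
Proof.
have zN : rdiff (- t) = - rdiff t by rewrite /rdiff sinN mulrN.
have wN : rsum (- t) = rsum t by rewrite /rsum zN sqrrN.
rewrite /pullback /rpar wN zN /kappa sinN sqrrN -/(kappa t).
by field; rewrite !gt_eqF// sqrtr_gt0.
Qed.

(** Reduction of the hyperelliptic integral to the elliptic one: folding the
    integral over [[- pi / 2, pi / 2]] at 0 removes the factor that is not
    invariant under the involution. *)
Lemma integral_euler_integrand :
  \int[mu]_(u in `[0, 1]) euler_integrand u = C * ellipticK k.
Proof.
have pi2 : 0 < pi / 2 :> R by rewrite divr_gt0 ?pi_gt0.
have [u0 u1] := upar_ends.
have cos0 (t : R) : t \in `]- (pi / 2), pi / 2[ -> 0 < cos t.
  by rewrite in_itv/=; exact: cos_gt0_pihalf.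
have pp : - (pi / 2) < pi / 2 :> R by rewrite gtrN.
have := @ge0_integral_subst_improper R upar dupar euler_integrand pullback
  (- (pi / 2)) (pi / 2) pp.
rewrite u0 u1 /Rintegral => ->.
- rewrite -/(Rintegral _ _ _) Rintegral_symmetric_itv//; last exact: continuous_pullback.
  under eq_Rintegral do rewrite pullbackDN.
  rewrite RintegralZl//; last exact/continuous_itv_integrable/continuous_legendre/modulus_lt1.
  by rewrite ellipticK_legendre// modulus_lt1.
- by apply: continuous_subspaceT => t; exact: is_derive_continuous (is_derive_upar t).
- move=> t /cos0 c0; split; first exact: is_derive_upar.
  + rewrite /dupar; move: (rpar t) (rsum t) (r0 t) (w0 t) => r w r_gt0 w_gt0.
    by rewrite divr_gt0 ?mulr_gt0 ?exprn_gt0.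
  + exact: continuous_dupar.
- by move=> u /continuous_euler_integrand; split => //; rewrite divr_ge0 ?sqrtr_ge0// !mulr_ge0 ?sqrtr_ge0.
- exact/continuous_subspaceT/continuous_pullback.
- exact: euler_integrand_upar.
Qed.

Lemma lauricella_integral_euler_integrand :
  lauricella_integral (1 / 2) [tuple - (1 / 2); 1 / 2; 1 / 2] 1 [tuple x1; x2; x3] =
  pi^-1 * \int[mu]_(u in `[0, 1]) euler_integrand u.
Proof.
rewrite lauricella_integral_arcsine; congr *%R.
apply: eq_Rintegral => u /[!inE]/=; rewrite in_itv/= => /andP[u0 u1].
have pos x : x < 1 -> 0 <= 1 - x * u.
  by move=> x1'; rewrite ltW// affine_gt0// u0.
rewrite !big_ord_recl big_ord0/= mulr1 !(tnth_nth 0)/= arcsineE//.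
rewrite powRN invrK div1r !powR12_sqrt ?pos ?x1_lt1 ?x2_lt1 ?x3_lt1//.
by rewrite /euler_integrand !invfM; ring.
Qed.

Lemma lauricellaFD_ellipticK :
  lauricellaFD (1 / 2) [tuple - (1 / 2); 1 / 2; 1 / 2] 1 [tuple x1; x2; x3] =
  C * ellipticK k / pi.
Proof.
rewrite [RHS]mulrC -integral_euler_integrand -lauricella_integral_euler_integrand /lauricellaFD.
case: ifPn => [/forallP xs1|//]; apply: lauricella_series_integral => // j.
have half : `|1 / 2 : R| <= 1 by rewrite ger0_norm//; lra.
by case: j => [[|[|[|]]]]//= ?; rewrite (tnth_nth 0)/= ?normrN.
Qed.

End reduction.

Theorem theorem4p3 (R : realType) (a b : R) (ha : 1 < a) (hab : a < b) :
  pi =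
  2 * Num.sqrt ((b ^+ 2 - a ^+ 2) * (a ^+ 2 * b ^+ 2 - 1))
    / (a * (b ^+ 2 - 1))
  * (ellipticK (b * (a ^+ 2 - 1) / (a * (b ^+ 2 - 1)))
     / lauricellaFD (1 / 2) [tuple - (1 / 2); 1 / 2; 1 / 2] 1
         [tuple 1 - a ^+ 4;
                (a ^+ 4 - 1) * b ^+ 2 / (a ^+ 2 - b ^+ 2);
                (a ^+ 4 - 1) / (a ^+ 2 * b ^+ 2 - 1)]).
Proof.
have k1 := modulus_lt1 ha hab; have K0 := ellipticK_gt0 k1.
rewrite (lauricellaFD_ellipticK ha hab).
have b1 : 1 < b by exact: lt_trans hab.
have C0 : 0 < 2 * Num.sqrt ((b ^+ 2 - a ^+ 2) * (a ^+ 2 * b ^+ 2 - 1))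
    / (a * (b ^+ 2 - 1)).
  have b0 : 0 < b by exact: lt_trans b1.
  have a0 : 0 < a by exact: lt_trans ha.
  have e1 : 0 < b ^+ 2 - a ^+ 2 by rewrite subr_gt0 ltr_pXn2r// nnegrE ltW.
  have e2 : 0 < a ^+ 2 * b ^+ 2 - 1.
    by rewrite subr_gt0 -exprMn exprn_egt1// mulr_egt1.
  have e3 : 0 < b ^+ 2 - 1 by rewrite subr_gt0 exprn_egt1.
  by apply: divr_gt0; rewrite mulr_gt0// sqrtr_gt0 mulr_gt0.
move: (ellipticK _) K0 (_ / (a * _)) C0 (pi_gt0 R) => K K0 C C0.
move: (pi : R) => p p0.
by field; rewrite !gt_eqF.
Qed.
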